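(* Let $X$ and $Y$ be Banach spaces and let $T\colon X\to Y$ be a bounded linear operator. Then for every positive integer $n$, $$\boldsymbol{\mu}_n(T)\le 3\,\boldsymbol{\mu}_n^{\circ\circ}(T).$$
   Context: For $k=1,2,\dots$ and integers $j$, the dyadic intervals are $\Delta_k^{(j)}:=\left[\frac{j-1}{2^k},\frac{j}{2^k}\right)$. The Haar functions are given by $\chi_k^{(j)}(t):=+2^{(k-1)/2}$ if $t\in\Delta_k^{(2j-1)}$, $\chi_k^{(j)}(t):=-2^{(k-1)/2}$ if $t\in\Delta_k^{(2j)}$, and $\chi_k^{(j)}(t):=0$ otherwise. For positive integers $m\le n$ let $\mathbb{D}_m^n:=\{(k,j): k=m,\dots,n;\ j=1,\dots,2^{k-1}\}$ (a finite dyadic tree). For a Banach space $Z$ and a square integrable $Z$-valued function $f$ on $[0,1)$, put $\|f\|_2:=\left(\int_0^1\|f(t)\|^2\,dt\right)^{1/2}$. For a bounded linear operator $T\colon X\to Y$ between Banach spaces, $\boldsymbol{\mu}_n(T)$ denotes the least constant $c\ge 1$ such that $$\bigg\|\sum_{(k,j)\in\mathbb{D}_1^n}\epsilon_k^{(j)}\,Tx_k^{(j)}\chi_k^{(j)}\bigg\|_2\le c\,\bigg\|\sum_{(k,j)\in\mathbb{D}_1^n}x_k^{(j)}\chi_k^{(j)}\bigg\|_2$$ for all families $(x_k^{(j)})_{(k,j)\in\mathbb{D}_1^n}$ of elements of $X$ and all signs $\epsilon_k^{(j)}=\pm1$. $\boldsymbol{\mu}_n^{\circ\circ}(T)$ denotes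 the least constant $c\ge 1$ such that the same inequality holds for all families $(x_k^{(j)})_{(k,j)\in\mathbb{D}_1^n}$ of elements of $X$ with the single fixed choice of signs $\epsilon_k^{(j)}=(-1)^k$. *)

(* Defs.v *)
From HB Require Import structures.
From mathcomp Require Import all_boot all_order all_algebra.
From mathcomp Require Import all_classical all_reals all_analysis.
Set Implicit Arguments.
Unset Strict Implicit.
Unset Printing Implicit Defensive.
Import Order.TTheory GRing.Theory Num.Theory.
Import numFieldNormedType.Exports.
Local Open Scope classical_set_scope.
Local Open Scope ring_scope.

Definition dyadic_interval (R : realType) (k : nat) (j : int) : interval R :=
  `[(j%:~R - 1) / 2 ^+ k, j%:~R / 2 ^+ k[.

(* The height 2^((k-1)/2) is a real power; the index k is meant to be >= 1. *)
Definition haar (R : realType) (k : nat) (j : int) (t : R) : R :=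
  if t \in dyadic_interval R k (2 * j - 1) then 2 `^ ((k%:R - 1) / 2)
  else if t \in dyadic_interval R k (2 * j) then - 2 `^ ((k%:R - 1) / 2)
  else 0.

(* Duplicate-free list of the (k, j) with m <= k <= n and 1 <= j <= 2^(k-1). *)
Definition dyadic_tree (m n : nat) : seq (nat * nat) :=
  [seq (k, j) | k <- index_iota m n.+1, j <- index_iota 1 (2 ^ k.-1).+1].

Definition haar_sum (R : realType) (Z : normedModType R) (n : nat)
    (z : nat * nat -> Z) (t : R) : Z :=
  \sum_(p <- dyadic_tree 1 n) haar p.1 p.2 t *: z p.

(* The integral is the real-valued Lebesgue integral over [0, 1). *)
Definition norm2 (R : realType) (Z : normedModType R) (f : R -> Z) : R :=
  Num.sqrt (\int[@lebesgue_measure R]_(t in `[0%R, 1%R[) (`|f t| ^+ 2)).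

(* The families x and eps are total on nat * nat, but only their values on
   dyadic_tree 1 n matter. *)
Definition sign_bound (R : realType) (X Y : normedModType R) (n : nat)
    (T : X -> Y) (eps : nat * nat -> R) (c : R) : Prop :=
  forall x : nat * nat -> X,
    norm2 (haar_sum n (fun p => eps p *: T (x p))) <=
    c * norm2 (haar_sum n x).

(* For a bounded linear T the sets below are nonempty, closed and bounded below
   by 1, so that inf is the least element. *)
Definition mu (R : realType) (X Y : normedModType R) (n : nat) (T : X -> Y) :
    R :=
  inf [set c : R | 1 <= c /\
    forall eps : nat * nat -> R,
      (forall p, p \in dyadic_tree 1 n -> eps p = 1 \/ eps p = -1) ->
      sign_bound n T eps c].

Definition mu_alt (R : realType) (X Y : normedModType R) (n : nat)
    (T : X -> Y) : R :=
  inf [set c : R | 1 <= c /\ sign_bound n T (fun p => (-1) ^+ p.1) c].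

(* Main.v *)
Require Import Defs.
From mathcomp Require Import all_boot all_order all_algebra.
From mathcomp Require Import all_classical all_reals all_analysis.
From mathcomp Require Import measurable_realfun zify ring lra.

(* Spread a tree of depth n over the levels 1, ..., 2n: the differences of level k
   go to level 2k - 1 where the prescribed sign is -1 and to level 2k where it
   is +1. The new martingale has the same distribution, and the alternating
   signs act on it as the prescribed signs did, so mu_n <= mu_alt_(2n).
   Conversely a martingale of length 2n is f = f1 + f2, with f1 from the first n
   levels and f2 from the last n; since |f1| <= |f|, |f2| <= 2 |f| in L2, and f2
   consists of 2^n rescaled martingales of length n,
   mu_alt_(2n) <= (1 + 2) mu_alt_n. *)

Set Implicit Arguments.
Unset Strict Implicit.
Unset Printing Implicit Defensive.
Import Order.TTheory GRing.Theory Num.Theory.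
Import numFieldNormedType.Exports.
Local Open Scope classical_set_scope.
Local Open Scope ring_scope.

(** * Energies of martingales on a finite binary tree *)

Section TreeEnergy.
Variables (R : realType) (Z : normedModType R).
Implicit Types (n : nat) (x : seq bool -> Z) (a : Z).

(* The sum, over the leaves of the binary tree of depth [n], of the squared norms
   of the values of the martingale that starts at [a] and whose difference
   below the node [s] is [+ x s] (left) or [- x s] (right). *)
Fixpoint tree_energy n x a : R :=
  if n is n'.+1 then
    tree_energy n' (x \o cons false) (a + x [::]) +
    tree_energy n' (x \o cons true) (a - x [::])
  else `|a| ^+ 2.

Lemma tree_energyN n x a :
  tree_energy n (fun s => - x s) (- a) = tree_energy n x a.
Proof.
elim: n x a => [|n IH] x a /=; first by rewrite normrN.
rewrite -(IH (x \o cons false)) -(IH (x \o cons true)) addrC.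
by rewrite opprB opprD opprK addrC [X in _ = _ + tree_energy _ _ X]addrC.
Qed.

(* The weights are those for which [tree_energy_alt_double] gives the constant
   9 = 3 + (3 / 2) * 4. *)
Lemma normD_sqr_le (u v : Z) : `|u + v| ^+ 2 <= 3 * `|u| ^+ 2 + 3 / 2 * `|v| ^+ 2.
Proof.
have := ler_normD u v; have := normr_ge0 u; have := normr_ge0 v.
have := normr_ge0 (u + v).
set p := `|u + v|; set q := `|u|; set r := `|v| => p0 r0 q0 pqr.
have : p ^+ 2 <= (q + r) ^+ 2 by rewrite lerXn2r ?nnegrE ?addr_ge0.
have := sqr_ge0 (2 * q - r); lra.
Qed.

Lemma normB_sqr_le (u v : Z) : `|u - v| ^+ 2 <= 2 * `|u| ^+ 2 + 2 * `|v| ^+ 2.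
Proof.
have := ler_normB u v; have := normr_ge0 u; have := normr_ge0 v.
have := normr_ge0 (u - v).
set p := `|u - v|; set q := `|u|; set r := `|v| => p0 r0 q0 pqr.
have : p ^+ 2 <= (q + r) ^+ 2 by rewrite lerXn2r ?nnegrE ?addr_ge0.
have := sqr_ge0 (q - r); lra.
Qed.

(** Convexity of the squared norm, as [u] is the midpoint of [u + v] and [u - v]. *)
Lemma norm_midpoint_sqr_le (u v : Z) : 2 * `|u| ^+ 2 <= `|u + v| ^+ 2 + `|u - v| ^+ 2.
Proof.
have : `|u *+ 2| <= `|u + v| + `|u - v|.
  by rewrite (_ : u *+ 2 = (u + v) + (u - v)) ?ler_normD // addrACA subrr addr0 mulr2n.
rewrite normrMn -[`|u| *+ 2]mulr_natl; have := normr_ge0 u.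
have := normr_ge0 (u + v); have := normr_ge0 (u - v).
set p := `|u + v|; set q := `|u - v|; set r := `|u| => q0 p0 r0 h.
have : (2 * r) ^+ 2 <= (p + q) ^+ 2 by rewrite lerXn2r ?nnegrE ?addr_ge0 ?mulr_ge0.
have := sqr_ge0 (p - q); lra.
Qed.

Lemma norm_sqr_le_tree_energy n x a : 2 ^+ n * `|a| ^+ 2 <= tree_energy n x a.
Proof.
elim: n x a => [|n IH] x a /=; first by rewrite mul1r.
apply: (le_trans _ (lerD (IH _ _) (IH _ _))).
rewrite exprSr -mulrA -mulrDr ler_pM2l ?exprn_gt0 //.
exact: norm_midpoint_sqr_le.
Qed.

Lemma tree_energy_ge0 n x a : 0 <= tree_energy n x a.
Proof.
by apply: le_trans (norm_sqr_le_tree_energy n x a); rewrite mulr_ge0 ?exprn_ge0.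
Qed.

(** Conditional expectations contract the L2 norm; [2 ^+ n] counts the leaves below a node reached
    after [m] steps. *)
Lemma tree_energy_trunc m n x a :
  2 ^+ n * tree_energy m x a <= tree_energy (m + n) x a.
Proof.
elim: m x a => [|m IH] x a /=; first exact: norm_sqr_le_tree_energy.
by rewrite mulrDr lerD.
Qed.

(* The energy of the part of the martingale that comes from the levels
   [m], ..., [m + n - 1]. *)
Fixpoint tail_energy m n x : R :=
  if m is m'.+1 then
    tail_energy m' n (x \o cons false) + tail_energy m' n (x \o cons true)
  else tree_energy n x 0.

Lemma tree_energyD_le n x (u v : Z) :
  tree_energy n x (u + v) <=
  3 * 2 ^+ n * `|u| ^+ 2 + 3 / 2 * tree_energy n x v.
Proof.
elim: n x v => [|n IH] x v /=; first by rewrite mulr1; exact: normD_sqr_le.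
rewrite -!addrA; apply: (le_trans (lerD (IH _ _) (IH _ _))).
by rewrite (exprS 2 n); lra.
Qed.

Lemma tree_energyB_le n x (u v : Z) :
  tree_energy n x (u - v) <=
  2 * tree_energy n x u + 2 * 2 ^+ n * `|v| ^+ 2.
Proof.
elim: n x u => [|n IH] x u /=; first by rewrite mulr1; exact: normB_sqr_le.
rewrite !(addrAC u (- v)); apply: (le_trans (lerD (IH _ _) (IH _ _))).
by rewrite (exprS 2 n); lra.
Qed.

Lemma tree_energy_split_le m n x a :
  tree_energy (m + n) x a <=
  3 * 2 ^+ n * tree_energy m x a + 3 / 2 * tail_energy m n x.
Proof.
elim: m x a => [|m IH] x a /=.
  by rewrite -[in leLHS](addr0 a) tree_energyD_le.
by apply: (le_trans (lerD (IH _ _) (IH _ _))); lra.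
Qed.

(** The tail is the whole martingale minus its head: below each node reached after [m] steps, the
    start [0] is written as [a - a], with [a] the value there. *)
Lemma tail_energy_le m n x a :
  tail_energy m n x <=
  2 * tree_energy (m + n) x a + 2 * 2 ^+ n * tree_energy m x a.
Proof.
elim: m x a => [|m IH] x a /=.
  by rewrite -[in leLHS](subrr a) tree_energyB_le.
by apply: (le_trans (lerD (IH _ (a + x [::])) (IH _ (a - x [::])))); lra.
Qed.

End TreeEnergy.

(** * Alternating and prescribed signs on trees *)

Section AltSign.
Variables (R : realType) (X Y : normedModType R) (T : X -> Y).

(** The root [[::]] belongs to level 1, hence the exponent [(size s).+1]. *)
Definition alt_transform (x : seq bool -> X) (s : seq bool) : Y :=
  (-1) ^+ (size s).+1 *: T (x s).

Lemma alt_transform_cons x b :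
  alt_transform x \o cons b = (fun s => - alt_transform (x \o cons b) s).
Proof. by apply/funext => s /=; rewrite /alt_transform /= exprS mulN1r scaleNr. Qed.

(** The tail consists of martingales of length [n] starting at 0. On each of them the signs
    alternate correctly up to a global sign, which does not change the energy. *)
Lemma tail_energy_alt_le m n (C : R) :
  (forall x, tree_energy n (alt_transform x) 0 <= C * tree_energy n x 0) ->
  forall x, tail_energy m n (alt_transform x) <= C * tail_energy m n x.
Proof.
move=> bnd.
have tailN k (y : seq bool -> Y) :
    tail_energy k n (fun s => - y s) = tail_energy k n y.
  elim: k y => [|k IH] y /=; last by rewrite -(IH (y \o _)) -(IH (y \o cons true)).
  by rewrite -{1}oppr0 tree_energyN.
elim: m => [|m IH] x /=; first exact: bnd.
by rewrite !alt_transform_cons !tailN mulrDr lerD.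
Qed.

Lemma tree_energy_alt_double n (C : R) : 0 <= C ->
  (forall x, tree_energy n (alt_transform x) 0 <= C * tree_energy n x 0) ->
  forall x, tree_energy (n + n) (alt_transform x) 0 <=
            9 * C * tree_energy (n + n) x 0.
Proof.
move=> C0 bnd x; apply: (le_trans (tree_energy_split_le n n _ 0)).
(* [h4] bounds the transformed head and [h1] the transformed tail; [h2] and [h3] lead back to the
   energy of the whole of [x]. *)
have h1 := tail_energy_alt_le n bnd x.
have h2 := ler_wpM2l C0 (tail_energy_le n n x 0).
have h3 := ler_wpM2l C0 (tree_energy_trunc n n x 0).
have h4 := ler_wpM2l (exprn_ge0 n (ler0n R 2)) (bnd x).
lra.
Qed.

(* The nodes selected by [e] are those of sign [-1]. A node of level [k] moves to
   level [2k-1] if its sign is [-1] and to level [2k] otherwise, where the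
   alternating signs are correct. *)
Fixpoint spread n (e : seq bool -> bool) (x : seq bool -> X) (s : seq bool) :
    X :=
  if n is n'.+1 then
    match s with
    | [::] => if e [::] then x [::] else 0
    | [:: c] => if e [::] then 0 else x [::]
    | c1 :: c2 :: s' =>
      let b := if e [::] then c1 else c2 in
      spread n' (e \o cons b) (x \o cons b) s'
    end
  else 0.

(** One level of each pair has zero differences and only copies the subtree, so every leaf value
    occurs [2 ^+ n] times. *)
Lemma tree_energy_spread n e x a :
  tree_energy n.*2 (spread n e x) a = 2 ^+ n * tree_energy n x a.
Proof.
elim: n e x a => [|n IH] e x a /=; first by rewrite mul1r.
have E c1 c2 : (spread n.+1 e x \o cons c1) \o cons c2 =
    spread n (e \o cons (if e [::] then c1 else c2))
             (x \o cons (if e [::] then c1 else c2)) by [].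
rewrite !E exprS; case: (e [::]); rewrite ?addr0 ?subr0 !IH; ring.
Qed.

(** Each recursion step descends two levels, which preserves the parity of the alternating signs;
    zero differences stay zero because [T 0 = 0]. *)
Lemma tree_energy_alt_spread n e x (b : Y) : T 0 = 0 ->
  tree_energy n.*2 (alt_transform (spread n e x)) b =
  2 ^+ n * tree_energy n (fun s => (-1) ^+ e s *: T (x s)) b.
Proof.
move=> T0; elim: n e x b => [|n IH] e x b /=; first by rewrite mul1r.
have E c1 c2 : (alt_transform (spread n.+1 e x) \o cons c1) \o cons c2 =
    alt_transform (spread n (e \o cons (if e [::] then c1 else c2))
                            (x \o cons (if e [::] then c1 else c2))).
  by apply/funext => s; rewrite /alt_transform /= !exprS !mulN1r !opprK.
rewrite !E exprS /alt_transform /= expr1 sqrrN expr1n.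
case: (e [::]); rewrite ?T0 ?scaler0 ?addr0 ?subr0 !IH /comp; ring.
Qed.

Lemma tree_energy_signs_le n (C : R) : 0 <= C -> T 0 = 0 ->
  (forall x, tree_energy n (alt_transform x) 0 <= C * tree_energy n x 0) ->
  forall (e : seq bool -> bool) x,
    tree_energy n (fun s => (-1) ^+ e s *: T (x s)) 0 <=
    9 * C * tree_energy n x 0.
Proof.
move=> C0 T0 bnd e x.
have := tree_energy_alt_double C0 bnd (spread n e x).
by rewrite addnn tree_energy_spread tree_energy_alt_spread // mulrCA ler_pM2l ?exprn_gt0.
Qed.

(** Provides some finite constant, so that the infimum defining [mu_alt] runs over a nonempty set.
    The starts [a] and [b] are arbitrary because they change in the induction. *)
Lemma tree_energy_crude_le (K : R) n : exists2 C, 0 <= C &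
  forall (x : seq bool -> X) (y : seq bool -> Y) a b,
  (forall s, `|y s| <= K * `|x s|) ->
  tree_energy n y b <= C * (`|b| ^+ 2 + tree_energy n x a).
Proof.
elim: n => [|n [C C0 IH]].
  by exists 1 => // x y a b _ /=; rewrite mul1r lerDl exprn_ge0.
(* The two new starts contribute at most [4 * |b|^2 + 4 * |y [::]|^2], and [hx] and [hy] bound the
   second term by [2 * K ^+ 2] times the energy of [x]. *)
exists (C * (4 + 2 * K ^+ 2)).
  by rewrite mulr_ge0 // addr_ge0 // mulr_ge0 // sqr_ge0.
move=> x y a b yx /=.
have := IH (x \o cons false) (y \o cons false) (a + x [::]) (b + y [::]) (fun s => yx _).
have := IH (x \o cons true) (y \o cons true) (a - x [::]) (b - y [::]) (fun s => yx _).
have := norm_sqr_le_tree_energy n (x \o cons false) (a + x [::]).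
have := norm_sqr_le_tree_energy n (x \o cons true) (a - x [::]).
set E1 := tree_energy n (x \o cons true) _.
set E2 := tree_energy n (x \o cons false) _.
set F1 := tree_energy n (y \o cons true) _.
set F2 := tree_energy n (y \o cons false) _.
move=> hE1 hE2 hF1 hF2.
have pow1 (r : R) : 0 <= r -> r <= 2 ^+ n * r.
  by move=> r0; rewrite ler_peMl // exprn_ege1 // ler1n.
have {hE1}hE1 := le_trans (pow1 _ (sqr_ge0 _)) hE1.
have {hE2}hE2 := le_trans (pow1 _ (sqr_ge0 _)) hE2.
have hx : 2 * `|x [::]| ^+ 2 <= E1 + E2.
  apply: (le_trans (norm_midpoint_sqr_le _ a)).
  by rewrite [leLHS]addrC distrC [x [::] + a]addrC lerD.
have hy : `|y [::]| ^+ 2 <= K ^+ 2 * `|x [::]| ^+ 2.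
  by rewrite -exprMn lerXn2r ?nnegrE // (le_trans _ (yx [::])).
have h1 := normB_sqr_le b (y [::]).
have := normB_sqr_le b (- y [::]); rewrite opprK normrN => h2.
have := ler_wpM2l (sqr_ge0 K) hx => hKx.
have E12 : 0 <= E1 + E2 by apply: le_trans hx; rewrite mulr_ge0 ?sqr_ge0.
apply: (le_trans (lerD hF2 hF1)); rewrite -mulrDr -mulrA ler_wpM2l //.
have := sqr_ge0 `|b|; have := sqr_ge0 K.
move=> K0 b0.
have := mulr_ge0 K0 b0; have := mulr_ge0 K0 E12.
lra.
Qed.

End AltSign.

(** * Dyadic intervals and the values of Haar functions on them *)

Section DyadicIntervals.
Variable R : realType.
Implicit Types (t : R) (i j k m n : nat).

Lemma mem_dyadic_interval k (j : int) t :
  (t \in dyadic_interval R k j) = (j%:~R - 1 <= t * 2 ^+ k < j%:~R).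
Proof. by rewrite in_itv /= ler_pdivrMr ?ltr_pdivlMr ?exprn_gt0. Qed.

Lemma dyadic_interval_inj k (i j : int) t : t \in dyadic_interval R k i ->
  (t \in dyadic_interval R k j) = (j == i).
Proof.
move=> ti; apply/idP/eqP => [|-> //]; move: ti.
rewrite !mem_dyadic_interval => /andP[i1 i2] /andP[j1 j2].
have ij : (i%:~R : R) < (j + 1)%:~R by rewrite intrD; lra.
have ji : (j%:~R : R) < (i + 1)%:~R by rewrite intrD; lra.
rewrite !ltr_int in ij ji; lia.
Qed.

Lemma dyadic_interval_disjoint k (i j : int) : i != j ->
  [disjoint [set` dyadic_interval R k i] & [set` dyadic_interval R k j]].
Proof.
move=> ij; apply/disj_setPS => t [/= ti tj]; move: ij.
by rewrite (dyadic_interval_inj _ tj) in ti; rewrite ti.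
Qed.

Lemma dyadic_interval_split k i :
  [set` dyadic_interval R k i.+1] =
  [set` dyadic_interval R k.+1 i.*2.+1] `|` [set` dyadic_interval R k.+1 i.*2.+2].
Proof.
have E t : t * 2 ^+ k.+1 = 2 * (t * 2 ^+ k) by rewrite (exprS 2); ring.
have E1 : (i.+1%:Z)%:~R = i%:R + 1 :> R by rewrite -pmulrn -natr1.
have E0 : i.*2%:R = 2 * i%:R :> R by rewrite -mul2n natrM.
have E2 : (i.*2.+1%:Z)%:~R = 2 * i%:R + 1 :> R
  by rewrite -pmulrn -[in LHS]natr1 E0.
have E3 : (i.*2.+2%:Z)%:~R = 2 * i%:R + 2 :> R
  by rewrite -pmulrn -[in LHS]natr1 -[in LHS]natr1 E0; ring.
apply/seteqP; split=> t /=; rewrite !mem_dyadic_interval E E1 E2 E3.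
  move=> /andP[h1 h2]; case: (ltP (2 * (t * 2 ^+ k)) (2 * i%:R + 1)) => h3.
    by left; apply/andP; split; lra.
  by right; apply/andP; split; lra.
by case=> /andP[h1 h2]; apply/andP; split; lra.
Qed.

Lemma lebesgue_measure_dyadic_interval k (j : int) :
  lebesgue_measure [set` dyadic_interval R k j] = (2 ^- k)%:E.
Proof.
rewrite lebesgue_measure_itv /= lte_fin ltr_pM2r ?invr_gt0 ?exprn_gt0 //.
by rewrite ltrBlDr ltrDl ltr01 -EFinB; congr EFin; ring.
Qed.

Lemma haar_dyadic k i j t : t \in dyadic_interval R k.+1 i.+1 ->
  haar k.+1 j.+1 t =
  if j == i./2 then (-1) ^+ odd i * 2 `^ (k%:R / 2) else 0.
Proof.
move=> ti; rewrite /haar !(dyadic_interval_inj _ ti) -[k.+1%:R]natr1 addrK.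
have -> : (2 * j.+1%:Z - 1 == i.+1%:Z) = (j == i./2) && ~~ odd i by lia.
have -> : (2 * j.+1%:Z == i.+1%:Z) = (j == i./2) && odd i by lia.
by case: eqP => //= _; case: odd; rewrite ?mul1r ?expr1 ?mulN1r.
Qed.

End DyadicIntervals.

(** * Norms of Haar sums as tree energies *)

Section HaarSums.
Variables (R : realType) (Z : normedModType R).
Implicit Types (t : R) (i j k m n : nat) (z : nat * nat -> Z).

Definition haar_level k z t : Z :=
  \sum_(1 <= j < (2 ^ k).+1) haar k.+1 j t *: z (k.+1, j).

Lemma haar_levelE k i (b : bool) z t : (i < 2 ^ k)%N ->
  t \in dyadic_interval R k.+1 (i.*2 + b).+1 ->
  haar_level k z t = ((-1) ^+ b * 2 `^ (k%:R / 2)) *: z (k.+1, i.+1).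
Proof.
move=> ik ti; rewrite /haar_level big_add1 /= big_mkord (bigD1 (Ordinal ik)) //=.
have half_ib : (i.*2 + b)./2 = i by rewrite addnC half_bit_double.
rewrite big1 => [|j /eqP ji].
  by rewrite addr0 (haar_dyadic _ ti) half_ib eqxx oddD odd_double oddb.
rewrite (haar_dyadic _ ti) half_ib; case: eqP => [jE|_]; last exact: scale0r.
by case: ji; apply: val_inj.
Qed.

Lemma haar_sumE n z t :
  haar_sum n z t = \sum_(0 <= k < n) haar_level k z t.
Proof.
rewrite /haar_sum /dyadic_tree big_allpairs_dep /= big_add1 /=.
by apply: eq_bigr => k _; apply: eq_bigr => j _ /=.
Qed.

(* Nodes are pairs (level, position), both counted from 0: the node [(k, i)]
   carries the Haar function of index [(k.+1, i.+1)]. *)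
Definition tree_node (s : seq bool) (p : nat * nat) : nat * nat :=
  foldl (fun p (b : bool) => (p.1.+1, p.2.*2 + b)%N) p s.

(** The height of the Haar function is absorbed, so that the martingale differences are exactly plus
    or minus these values. *)
Definition node_coef z (p : nat * nat) (s : seq bool) : Z :=
  let q := tree_node s p in 2 `^ (q.1%:R / 2) *: z (q.1.+1, q.2.+1).

(** Induction by halving the interval: on each half the first level is constant and is absorbed into
    [a]. Measurability is carried along for the additivity of the integral. The factor
    [2 ^- (m + n)] is the length of a leaf interval. *)
Lemma haar_levels_integral n m i z a : (i < 2 ^ m)%N ->
  let f t := `|a + \sum_(m <= k < m + n) haar_level k z t| ^+ 2 in
  measurable_fun [set` dyadic_interval R m i.+1] f /\
  (\int[lebesgue_measure]_(t in [set` dyadic_interval R m i.+1]) (f t)%:E =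
   (2 ^- (m + n) * tree_energy n (node_coef z (m, i)) a)%:E)%E.
Proof.
elim: n m i a => [|n IH] m i a im f.
  have fE t : f t = `|a| ^+ 2 by rewrite /f addn0 big_geq // addr0.
  split.
    by rewrite (_ : f = cst (`|a| ^+ 2)); [exact: measurable_cst|apply/funext].
  under eq_integral do rewrite fE.
  rewrite integral_cst //= lebesgue_measure_dyadic_interval.
  by rewrite -EFinM mulrC addn0.
have child (b : bool) : (i.*2 + b < 2 ^ m.+1)%N.
  by rewrite expnS mul2n -ltn_half_double addnC half_bit_double.
pose c (b : bool) := a + (-1) ^+ b *: node_coef z (m, i) [::].
have fE (b : bool) t : t \in [set` dyadic_interval R m.+1 (i.*2 + b).+1] ->
    `|c b + \sum_(m.+1 <= k < m.+1 + n) haar_level k z t| ^+ 2 = f t.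
  rewrite inE /= => tb; rewrite /f addnS (@big_ltn _ _ _ m) ?ltnS ?leq_addr //.
  by rewrite (haar_levelE _ im tb) addrA /c /node_coef scalerA.
have [mf If] := IH _ _ (c false) (child false).
have [mt It] := IH _ _ (c true) (child true).
have {}mf := eq_measurable_fun _ (fE false) mf.
have {}mt := eq_measurable_fun _ (fE true) mt.
rewrite addn0 in mf If; rewrite addn1 in mt It.
have mU : measurable_fun [set` dyadic_interval R m i.+1] f.
  by rewrite dyadic_interval_split; apply/measurable_funU.
split=> //; rewrite dyadic_interval_split ge0_integral_setU //=; first last.
- by apply: dyadic_interval_disjoint; lia.
- by move=> t _; rewrite lee_fin sqr_ge0.
- by apply/measurable_EFinP; rewrite -dyadic_interval_split.
have Ef : (\int[lebesgue_measure]_(t in [set` dyadic_interval R m.+1 i.*2.+1]) (f t)%:E =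
   (2 ^- (m.+1 + n) * tree_energy n (node_coef z (m.+1, i.*2)) (c false))%:E)%E.
  rewrite -If; apply: eq_integral => t tI; rewrite -(fE false) ?addn0 //.
have Et : (\int[lebesgue_measure]_(t in [set` dyadic_interval R m.+1 i.*2.+2]) (f t)%:E =
   (2 ^- (m.+1 + n) * tree_energy n (node_coef z (m.+1, i.*2.+1)) (c true))%:E)%E.
  by rewrite -It; apply: eq_integral => t tI; rewrite -(fE true) ?addn1.
rewrite Ef Et -EFinD -mulrDr addnS /c expr0 expr1 scale1r scaleN1r.
have E (b : bool) : node_coef z (m, i) \o cons b = node_coef z (m.+1, i.*2 + b)%N by [].
by rewrite !E addn0 addn1.
Qed.

Lemma norm2_haar_sum n z :
  norm2 (haar_sum n z) =
  Num.sqrt (2 ^- n * tree_energy n (node_coef z (0, 0)%N) 0).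
Proof.
have [_] := @haar_levels_integral n 0 0 z 0 isT.
have -> : dyadic_interval R 0 1 = `[0, 1[ by rewrite /dyadic_interval subrr mul0r expr0 divr1.
rewrite add0n => E; rewrite /norm2 /Rintegral.
congr Num.sqrt; rewrite -[RHS]/(fine _%:E) -E; congr fine.
by apply: eq_integral => t _; rewrite add0r haar_sumE.
Qed.

(* The [k] lowest binary digits of [j], most significant first. *)
Fixpoint node_path k j : seq bool :=
  if k is k'.+1 then rcons (node_path k' j./2) (odd j) else [::].

Lemma tree_nodeK s : let q := tree_node s (0, 0)%N in node_path q.1 q.2 = s.
Proof.
elim/last_ind: s => [//|s b IH] /=.
rewrite /tree_node foldl_rcons /= -/(tree_node s _) addnC half_bit_double.
by rewrite IH oddD odd_double oddb addbF.
Qed.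

Lemma tree_node_level s p : (tree_node s p).1 = (size s + p.1)%N.
Proof. by elim: s p => [//|b s IH] p /=; rewrite IH /= addnS. Qed.

(** Lets a bound for all families of Haar coefficients be used for all functions on the nodes. The
    [.-1] undo the shift between counting from 0 and from 1. *)
Lemma node_coef_surj (x : seq bool -> Z) : exists z, node_coef z (0, 0)%N = x.
Proof.
exists (fun p => (2 `^ (p.1.-1%:R / 2))^-1 *: x (node_path p.1.-1 p.2.-1)).
apply/funext => s; rewrite /node_coef /= tree_nodeK scalerA mulfV ?scale1r //.
Qed.

End HaarSums.

(** * Transfer to Haar sums and comparison of the constants *)

Lemma sign_boundP (R : realType) (X Y : normedModType R) (n : nat) (T : {linear X -> Y})
    (eps : nat * nat -> R) (c : R) : 0 <= c ->
  sign_bound n T eps c <->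
  forall x : seq bool -> X,
    tree_energy n (fun s => let q := tree_node s (0, 0)%N in
                            eps (q.1.+1, q.2.+1) *: T (x s)) 0 <=
    c ^+ 2 * tree_energy n x 0.
Proof.
move=> c0.
have coefT z : node_coef (fun p => eps p *: T (z p)) (0, 0)%N =
    fun s => let q := tree_node s (0, 0)%N in
             eps (q.1.+1, q.2.+1) *: T (node_coef z (0, 0)%N s).
  apply/funext => s; rewrite /node_coef /= (linearZ_LR T) !scalerA; congr (_ *: _).
  exact: mulrC.
have cE (r : R) : c * Num.sqrt r = Num.sqrt (c ^+ 2 * r).
  by rewrite sqrtrM ?sqr_ge0 // sqrtr_sqr ger0_norm.
have main z : (norm2 (haar_sum n (fun p => eps p *: T (z p))) <=
    c * norm2 (haar_sum n z)) =
  (tree_energy n (fun s => let q := tree_node s (0, 0)%N in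
             eps (q.1.+1, q.2.+1) *: T (node_coef z (0, 0)%N s)) 0 <=
   c ^+ 2 * tree_energy n (node_coef z (0, 0)%N) 0).
  rewrite !norm2_haar_sum cE coefT ler_sqrt; last first.
    by rewrite !mulr_ge0 ?sqr_ge0 ?invr_ge0 ?exprn_ge0 ?tree_energy_ge0.
  by rewrite mulrCA ler_pM2l // invr_gt0 exprn_gt0.
split=> [H x|H x]; last by rewrite main.
by have [z <-] := node_coef_surj x; rewrite -main.
Qed.

Lemma eq_sign_bound (R : realType) (X Y : normedModType R) (n : nat) (T : X -> Y)
    (eps eps' : nat * nat -> R) (c : R) :
  {in dyadic_tree 1 n, eps =1 eps'} -> sign_bound n T eps c -> sign_bound n T eps' c.
Proof.
move=> E H x; rewrite (_ : haar_sum _ _ = haar_sum n (fun p => eps p *: T (x p))) //.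
by apply/funext => t; apply: eq_big_seq => p pn; rewrite E.
Qed.

Lemma alt_sign_boundP (R : realType) (X Y : normedModType R) (n : nat)
    (T : {linear X -> Y}) (c : R) : 0 <= c ->
  sign_bound n T (fun p => (-1) ^+ p.1) c <->
  forall x, tree_energy n (alt_transform T x) 0 <= c ^+ 2 * tree_energy n x 0.
Proof.
move=> c0; have E x : alt_transform T x = fun s => let q := tree_node s (0, 0)%N in
    (-1) ^+ (q.1.+1, q.2.+1).1 *: T (x s).
  by apply/funext => s; rewrite /= tree_node_level addn0.
by split=> [/(sign_boundP n T _ c0) H x|H];
  [rewrite E|apply/(sign_boundP n T _ c0) => x; rewrite -E].
Qed.

Lemma sign_bound_alt (R : realType) (X Y : normedModType R) (n : nat)
    (T : {linear X -> Y}) (eps : nat * nat -> R) (c : R) : 0 <= c ->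
  (forall p, p \in dyadic_tree 1 n -> eps p = 1 \/ eps p = -1) ->
  sign_bound n T (fun p => (-1) ^+ p.1) c -> sign_bound n T eps (3 * c).
Proof.
move=> c0 eps1 /(alt_sign_boundP n T c0) H.
(* Off the tree [eps] is arbitrary, so it is replaced by genuine signs that agree with it on the
   tree. *)
apply: (@eq_sign_bound _ _ _ _ _ (fun p => (-1) ^+ (eps p == -1))) => [p /eps1[]->|].
- by rewrite gt_eqF // (lt_trans (ltrN10 R)) ?ltr01.
- by rewrite eqxx expr1.
apply/sign_boundP; first by rewrite mulr_ge0.
move=> x; rewrite exprMn (_ : 3 ^+ 2 = 9); last by ring.
exact: (tree_energy_signs_le (sqr_ge0 c) (linear0 T) H
  (fun s => let q := tree_node s (0, 0)%N in eps (q.1.+1, q.2.+1) == -1)).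
Qed.

Lemma alt_sign_bound_exists (R : realType) (X Y : normedModType R) (n : nat)
    (T : {linear X -> Y}) : bounded_near T (nbhs (0 : X)) ->
  exists2 c, 1 <= c & sign_bound n T (fun p => (-1) ^+ p.1) c.
Proof.
move=> /linear_boundedP/pinfty_ex_gt0[K K0 TK].
have [C C0 HC] := tree_energy_crude_le X Y K n.
(* [1 + C] is at least 1 and its square is at least [C]. *)
exists (1 + C); first by rewrite lerDl.
apply/alt_sign_boundP => [|x]; first by rewrite addr_ge0.
apply: (@le_trans _ _ (C * tree_energy n x 0)).
  have := HC x (alt_transform T x) 0 0; rewrite normr0 expr0n add0r; apply => s.
  by rewrite normrZ normrX normrN1 expr1n mul1r.
apply: ler_wpM2r; first exact: tree_energy_ge0.
by have := sqr_ge0 C; rewrite sqrrD; lra.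
Qed.

Theorem mainTheorem1 (R : realType) (X Y : completeNormedModType R)
  (T : {linear X -> Y}) (T_bounded : bounded_near T (nbhs (0 : X)))
  (n : nat) (n_gt0 : (0 < n)%N) :
  mu n T <= 3 * mu_alt n T.
Proof.
rewrite mulrC -ler_pdivrMr //.
(* It suffices that [3 * c] is admissible for [mu] whenever [c] is admissible for [mu_alt], once
   some such [c] exists. *)
apply: lb_le_inf => [|c [c1 Hc]].
  by have [c c1 Hc] := alt_sign_bound_exists n T_bounded; exists c.
rewrite ler_pdivrMr // mulrC; apply: ge_inf; first by exists 1 => d [].
split=> [|eps eps1]; first by lra.
by apply: sign_bound_alt => //; lra.
Qed.
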